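(* Let $G=(V,E)$ be a locally finite graph, and let $x,y\in V$ with $d(x,y)=\delta\ge 2$ (with $\delta$ a finite integer). Then the function $p\mapsto \kappa_p(x,y)$ is concave and piecewise linear over $[0,1]$ with at most $3$ linear parts (that is, $[0,1]$ can be divided into at most three consecutive closed intervals on each of which the function is affine).
   Context: Graphs have no multiple edges and no self loops. $d_v$ denotes the degree of the vertex $v$, $w\sim v$ means that $w$ and $v$ are adjacent, and $d(v,w)$ is the combinatorial distance (length of a shortest path). For $v\in V$ and $p\in[0,1]$, $\mu_v^p$ is the probability measure on $V$ with $\mu_v^p(v)=p$, $\mu_v^p(z)=\frac{1-p}{d_v}$ if $z\sim v$, and $\mu_v^p(z)=0$ otherwise. For probability measures $\mu_1,\mu_2$ on $V$, the Wasserstein distance is $W_1(\mu_1,\mu_2)=\inf_{\pi}\sum_{v\in V}\sum_{w\in V} d(v,w)\pi(v,w)$, the infimum over all $\pi:V\times V\to[0,1]$ with $\mu_1(v)=\sum_{w}\pi(v,w)$ and $\mu_2(w)=\sum_{v}\pi(v,w)$. The $p$-Ollivier-Ricci curvature is $\kappa_p(x,y)=1-\frac{W_1(\mu_x^p,\mu_y^p)}{d(x,y)}$. *)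

(* Defs.v *)
From mathcomp Require Import all_boot all_order all_algebra.
From mathcomp Require Import finmap.
From mathcomp Require Import all_classical all_reals all_analysis.

Set Implicit Arguments.
Unset Strict Implicit.
Unset Printing Implicit Defensive.

Import Order.TTheory GRing.Theory Num.Theory.
Import numFieldNormedType.Exports.

Local Open Scope classical_set_scope.
Local Open Scope ring_scope.

Record simple_graph (V : Type) := SimpleGraph {
  adj : rel V;
  adj_sym : symmetric adj;
  adj_irr : irreflexive adj }.

Section OllivierRicci.
Context {R : realType} {V : choiceType} (G : simple_graph V).

Definition neighbors (v : V) : set V := [set w | adj G v w].

Definition locally_finite : Prop := forall v, finite_set (neighbors v).

Definition deg (v : V) : nat := #|` fset_set (neighbors v)|.

(* G need not be connected: the infimum is +oo when no path joins v to w. *)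
Definition gdist (v w : V) : \bar R :=
  ereal_inf [set (size s)%:R%:E | s in
    [set s : seq V | path (adj G) v s /\ last v s = w]].

Definition mu (p : R) (v : V) : V -> R := fun z =>
  if z == v then p else if adj G v z then (1 - p) / (deg v)%:R else 0.

Definition coupling (mu1 mu2 : V -> R) : set (V -> V -> R) :=
  [set pi | [/\ forall v w, 0 <= pi v w <= 1,
                forall v, (\esum_(w in setT) (pi v w)%:E = (mu1 v)%:E)%E
              & forall w, (\esum_(v in setT) (pi v w)%:E = (mu2 w)%:E)%E]].

(* Pairs of vertices in different components contribute 0 when they carry no
   mass, since +oo * 0 = 0 in \bar R. *)
Definition cost (pi : V -> V -> R) : \bar R :=
  (\esum_(v in setT) \esum_(w in setT) gdist v w * (pi v w)%:E)%E.

Definition W1 (mu1 mu2 : V -> R) : \bar R :=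
  ereal_inf [set cost pi | pi in coupling mu1 mu2].

(* For v, w at finite distance in a locally finite graph and 0 <= p <= 1, both
   W1 and the distance are finite, so that [fine] loses nothing. *)
Definition kappa (p : R) (v w : V) : R :=
  1 - fine (W1 (mu p v) (mu p w)) / fine (gdist v w).

End OllivierRicci.

Arguments gdist R {V} G v w.

Definition concave_on {R : realType} (D : set R) (f : R -> R) : Prop :=
  convex_function (D : set R^o) (fun x => - f x : R^o).

Definition affine_on {R : realType} (D : set R) (f : R -> R) : Prop :=
  exists a b : R, {in D, forall x, f x = a * x + b}.

(* Main.v *)
(* Kantorovich duality with integer potentials: since all distances are integers,
   W(p) = W1(mu_x^p, mu_y^p) is the maximum of Sum u mu_x^p + Sum v mu_y^p over
   integer u, v with u(a) + v(b) <= d(a, b). Each such pair contributes an affine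
   function of p whose value at p = 1 is the integer j = u(x) + v(y) <= delta, so
   W is convex.
   For 0 < p < 1 both x and y carry mass, and complementary slackness provides
   z next to (or equal to) y with u(x) + v(z) = d(x, z) >= delta - 1, and a with
   u(a) + v(y) = d(a, y), whence v(z) <= v(y) + 1. Thus j >= delta - 2, and on
   ]0, 1[ W is the maximum of three affine functions, the best ones with
   j = delta - 2, delta - 1, delta; closedness extends this to [0, 1]. *)

Require Import Defs.
From mathcomp Require Import all_boot all_order all_algebra.
From mathcomp Require Import finmap.
From mathcomp Require Import all_classical all_reals all_analysis.
From mathcomp Require Import lra ring zify.

Set Implicit Arguments.
Unset Strict Implicit.
Unset Printing Implicit Defensive.

Import Order.TTheory GRing.Theory Num.Theory.
Import numFieldNormedType.Exports.
Local Open Scope classical_set_scope.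
Local Open Scope ring_scope.

(** * Affine functions on the unit interval and maxima of three of them *)

(* [l] encodes the affine function by its values [l.1] at 1 and [l.2] at 0. *)
Definition line (R : realType) (l : R * R) (q : R) : R :=
  q * l.1 + (1 - q) * l.2.

Definition slope (R : realType) (l : R * R) : R := l.1 - l.2.

Lemma line_affine (R : realType) (l : R * R) q : line l q = slope l * q + l.2.
Proof. rewrite /line /slope; ring. Qed.

(* The crossing point may lie outside [0, 1], as it must for distinct parallel
   lines. *)
Lemma line_crossing (R : realType) (l m : R * R) : slope l <= slope m ->
  exists t, forall q : R, 0 <= q <= 1 ->
    (q <= t -> line m q <= line l q) /\ (t <= q -> line l q <= line m q).
Proof.
case: l m => [l1 l2] [m1 m2]; rewrite /line /slope /= => h.
have [e|ne] := eqVneq (l1 - l2) (m1 - m2).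
  have [h0|h0] := leP l2 m2.
    exists (-1) => q /andP[q0 q1]; split=> ?; [lra|nra].
  by exists 2 => q /andP[q0 q1]; split=> ?; [nra|lra].
have {ne h}d : 0 < (m1 - m2) - (l1 - l2) by rewrite subr_gt0 lt_neqAle ne h.
exists ((l2 - m2) / ((m1 - m2) - (l1 - l2))) => q _.
by split; rewrite ?ler_pdivlMr ?ler_pdivrMr // => ?; nra.
Qed.

Definition max3 (R : realType) (l1 l2 l3 : R * R) (q : R) : R :=
  Num.max (line l1 q) (Num.max (line l2 q) (line l3 q)).

Lemma affine_on_line (R : realType) (D : set R) (l : R * R) (f : R -> R) :
  (forall q, D q -> f q = line l q) -> affine_on D f.
Proof.
by move=> h; exists (slope l), l.2 => q /[!inE] /h ->; rewrite line_affine.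
Qed.

Lemma affine_on_point (R : realType) (D : set R) (f : R -> R) (a : R) :
  (forall q, D q -> q = a) -> affine_on D f.
Proof. by move=> h; exists 0, (f a) => q /[!inE] /h ->; rewrite mul0r add0r. Qed.

(** Crossing points are arbitrary reals, so the breakpoints are clamped to [0, 1]. A piece lying
    outside collapses to an endpoint, and on a single point every function is affine. *)
Lemma three_pieces_clamp (R : realType) (f : R -> R) (l1 l2 l3 : R * R) (s t : R) :
  s <= t ->
  (forall q : R, 0 <= q <= 1 -> q <= s -> f q = line l1 q) ->
  (forall q : R, 0 <= q <= 1 -> s <= q -> q <= t -> f q = line l2 q) ->
  (forall q : R, 0 <= q <= 1 -> t <= q -> f q = line l3 q) ->
  exists s t : R, [/\ 0 <= s, s <= t, t <= 1,
    affine_on `[0, s] f & affine_on `[s, t] f /\ affine_on `[t, 1] f].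
Proof.
move=> st f1 f2 f3.
pose c (z : R) := if z < 0 then 0 else if z < 1 then z else 1.
have c01 z : 0 <= c z <= 1.
  by rewrite /c; case: (ltP z 0) => ?; [lra|case: (ltP z 1) => ?; lra].
have clt0 z : z < 0 -> c z = 0 by rewrite /c => ->.
have cge1 z : 1 <= z -> c z = 1.
  by move=> h; rewrite /c; case: (ltP z 0) => ?; [lra|case: (ltP z 1) => ?; lra].
have cle z : 0 <= z -> c z <= z.
  by move=> h; rewrite /c; case: (ltP z 0) => ?; [lra|case: (ltP z 1) => ?; lra].
have cge z : z <= 1 -> z <= c z.
  by move=> h; rewrite /c; case: (ltP z 0) => ?; [lra|case: (ltP z 1) => ?; lra].
have cst : c s <= c t.
  rewrite /c; case: (ltP s 0) => ?; case: (ltP t 0) => ?; try lra.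
    by case: (ltP t 1) => ?; lra.
  by case: (ltP s 1) => ?; case: (ltP t 1) => ?; lra.
move: (c01 s) (c01 t) => /andP[cs0 cs1] /andP[ct0 ct1].
exists (c s), (c t); split => //; last split.
- have [s0|s0] := ltP s 0.
    rewrite (clt0 _ s0); apply: (@affine_on_point _ _ _ 0) => q /=.
    by rewrite in_itv/= => ?; lra.
  apply: (affine_on_line (l := l1)) => q /=; rewrite in_itv/= => /andP[q0 qs].
  by apply: f1; [lra|exact: le_trans (cle _ s0)].
- have [t0|t0] := ltP t 0.
    apply: (@affine_on_point _ _ _ 0) => q /=.
    by rewrite (clt0 _ t0) in_itv/= => ?; lra.
  have [s1|s1] := leP 1 s.
    apply: (@affine_on_point _ _ _ 1) => q /=.
    by rewrite (cge1 _ s1) in_itv/= => ?; lra.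
  apply: (affine_on_line (l := l2)) => q /=; rewrite in_itv/= => /andP[sq qt].
  apply: f2; first lra; first exact: le_trans (cge _ (ltW s1)) _.
  exact: le_trans (cle _ t0).
- have [t1|t1] := leP 1 t.
    rewrite (cge1 _ t1); apply: (@affine_on_point _ _ _ 1) => q /=.
    by rewrite in_itv/= => ?; lra.
  apply: (affine_on_line (l := l3)) => q /=; rewrite in_itv/= => /andP[tq q1].
  by apply: f3; [lra|exact: le_trans (cge _ (ltW t1)) _].
Qed.

(** With slopes in increasing order, dominance passes from [l1] towards [l3] as q grows. If
    [t12 <= t23], each line has its turn; otherwise [l2] is nowhere on [0, 1] strictly the largest,
    and the only switch is at [t13]. *)
Lemma max3_pieces_sorted (R : realType) (f : R -> R) (l1 l2 l3 : R * R) :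
  slope l1 <= slope l2 -> slope l2 <= slope l3 ->
  (forall q : R, 0 <= q <= 1 -> f q = max3 l1 l2 l3 q) ->
  exists s t : R, [/\ 0 <= s, s <= t, t <= 1,
    affine_on `[0, s] f & affine_on `[s, t] f /\ affine_on `[t, 1] f].
Proof.
move=> l12 l23 fE.
have [t12 c12] := line_crossing l12.
have [t23 c23] := line_crossing l23.
have [t13 c13] := line_crossing (le_trans l12 l23).
have f1 q : 0 <= q <= 1 -> line l2 q <= line l1 q ->
    line l3 q <= line l1 q -> f q = line l1 q.
  by move=> q01 h h'; rewrite fE // /max3; apply/max_idPl; rewrite ge_max h.
have f2 q : 0 <= q <= 1 -> line l1 q <= line l2 q ->
    line l3 q <= line l2 q -> f q = line l2 q.
  by move=> q01 h h'; rewrite fE // /max3 (max_idPl h'); exact/max_idPr.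
have f3 q : 0 <= q <= 1 -> line l1 q <= line l3 q ->
    line l2 q <= line l3 q -> f q = line l3 q.
  by move=> q01 h h'; rewrite fE // /max3 (max_idPr h'); exact/max_idPr.
have [h|h] := leP t12 t23.
  apply: (three_pieces_clamp (l1 := l1) (l2 := l2) (l3 := l3) (s := t12) (t := t23)) => // q q01;
    move: (c12 q q01) (c23 q q01) => [a b] [c d].
  - move=> q12; apply: f1 => //; first exact: a.
    exact: le_trans (c (le_trans q12 h)) (a q12).
  - by move=> ? ?; apply: f2 => //; [exact: b|exact: c].
  - move=> q23; apply: f3 => //; last exact: d.
    exact: le_trans (b (le_trans h q23)) (d q23).
(* The middle piece shrinks to the point [t13], where [l1] still attains the maximum. *)
apply: (three_pieces_clamp (l1 := l1) (l2 := l1) (l3 := l3) (s := t13) (t := t13)) => // q q01;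
  move: (c12 q q01) (c23 q q01) (c13 q q01) => [a b] [c d] [k g].
- move=> q13; apply: f1 => //; last exact: k.
  have [/a//|/ltW q12] := leP q t12.
  exact: le_trans (d (le_trans (ltW h) q12)) (k q13).
- move=> _ q13; apply: f1 => //; last exact: k.
  have [/a//|/ltW q12] := leP q t12.
  exact: le_trans (d (le_trans (ltW h) q12)) (k q13).
- move=> q13; apply: f3 => //; first exact: g.
  have [/d//|q23] := leP t23 q.
  exact: le_trans (a (ltW (lt_trans q23 h))) (g q13).
Qed.

Lemma max3_pieces (R : realType) (f : R -> R) (l1 l2 l3 : R * R) :
  (forall q : R, 0 <= q <= 1 -> f q = max3 l1 l2 l3 q) ->
  exists s t : R, [/\ 0 <= s, s <= t, t <= 1,
    affine_on `[0, s] f & affine_on `[s, t] f /\ affine_on `[t, 1] f].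
Proof.
move=> fE.
have [h12|/ltW h12] := leP (slope l1) (slope l2);
have [h23|/ltW h23] := leP (slope l2) (slope l3);
have [h13|/ltW h13] := leP (slope l1) (slope l3).
- exact: (max3_pieces_sorted (l1 := l1) (l2 := l2) (l3 := l3)).
- exact: (max3_pieces_sorted (l1 := l1) (l2 := l2) (l3 := l3)).
- apply: (max3_pieces_sorted (l1 := l1) (l2 := l3) (l3 := l2)) => // q /fE ->.
  by rewrite /max3 (maxC (line l3 q)).
- apply: (max3_pieces_sorted (l1 := l3) (l2 := l1) (l3 := l2)) => // q /fE ->.
  by rewrite /max3 maxA maxC.
- apply: (max3_pieces_sorted (l1 := l2) (l2 := l1) (l3 := l3)) => // q /fE ->.
  by rewrite /max3 maxCA.
- apply: (max3_pieces_sorted (l1 := l2) (l2 := l3) (l3 := l1)) => // q /fE ->.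
  by rewrite /max3 maxC maxA.
- apply: (max3_pieces_sorted (l1 := l3) (l2 := l2) (l3 := l1)) => //.
  by move=> q /fE ->; rewrite /max3 maxC -maxA maxCA.
- apply: (max3_pieces_sorted (l1 := l3) (l2 := l2) (l3 := l1)) => // q /fE ->.
  by rewrite /max3 maxC (maxC (line l2 q)) maxA.
Qed.

(** The perturbation goes towards 1/2, so that an endpoint of [0, 1] is pushed into the open
    interval. *)
Lemma line_lt_near (R : realType) (l m : R * R) (p : R) :
  line l p < line m p -> exists2 e, 0 < e & forall r, 0 <= r -> r <= e ->
    line l (p + r * (2^-1 - p)) < line m (p + r * (2^-1 - p)).
Proof.
move=> h; set d := line m p - line l p.
set D := line m 2^-1 - line l 2^-1.
have d0 : 0 < d by rewrite subr_gt0.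
have D0 : 0 < d + `|D| by rewrite ltr_wpDr.
(* Along the segment the gap is d - r (d - D). Since |d - D| <= d + |D|, this radius keeps it at
   least d / 2. *)
exists (d / (2 * (d + `|D|))) => [|r r0 re].
  by rewrite divr_gt0 // mulr_gt0.
rewrite -subr_gt0.
have -> : line m (p + r * (2^-1 - p)) - line l (p + r * (2^-1 - p)) =
    d - r * (d - D) by rewrite /d /D /line; ring.
have : r * (2 * (d + `|D|)) <= d by rewrite -ler_pdivlMr // mulr_gt0.
have := ler_normB d D; rewrite (gtr0_norm d0).
have := ler_norm (d - D); nra.
Qed.

(** A strict violation at p would be one against each of the three lines, hence would persist at a
    nearby interior point. *)
Lemma line_le_max3_closure (R : realType) (l l1 l2 l3 : R * R) (p : R) :
  0 <= p <= 1 ->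
  (forall q : R, 0 < q < 1 -> line l q <= max3 l1 l2 l3 q) ->
  line l p <= max3 l1 l2 l3 p.
Proof.
move=> p01 h; rewrite leNgt /max3; apply/negP; rewrite !gt_max => /and3P[].
move=> /line_lt_near[e1 e10 h1] /line_lt_near[e2 e20 h2] /line_lt_near[e3 e30 h3].
pose r := Num.min 2^-1 (Num.min e1 (Num.min e2 e3)).
have r0 : 0 < r by rewrite !lt_min e10 e20 e30 invr_gt0 ltr0n.
have /and4P[r1 re1 re2 re3] : [&& r <= 2^-1, r <= e1, r <= e2 & r <= e3].
  by rewrite !ge_min !lexx !orbT.
have /h : 0 < p + r * (2^-1 - p) < 1 by apply/andP; split; nra.
by rewrite leNgt !gt_max h1 ?h2 ?h3 // ltW.
Qed.

(* [L] is the supremum of the lines below [W] with value [j] at 1, or [l0] if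
   there is none. *)
Lemma best_line (R : realType) (W : R -> R) (l0 : R * R) (j : R) :
  (forall q : R, 0 <= q <= 1 -> line l0 q <= W q) ->
  exists L, (forall q : R, 0 <= q <= 1 -> line L q <= W q) /\
    forall c, (forall q : R, 0 <= q <= 1 -> line (j, c) q <= W q) ->
      forall q : R, 0 <= q <= 1 -> line (j, c) q <= line L q.
Proof.
move=> l0W; pose S := [set c | forall q : R, 0 <= q <= 1 -> line (j, c) q <= W q].
have [[c1 Sc1]|S0] := pselect (S !=set0); last first.
  by exists l0; split => // c Sc; exfalso; apply: S0; exists c.
have i0 : (0 : R) <= (0 : R) <= (1 : R) by rewrite lexx ler01.
(* At 0 the line takes the value c, so [W 0] bounds c. *)
have ubS : has_ubound S.
  by exists (W 0) => c /(_ 0 i0); rewrite /line /= mul0r add0r subr0 mul1r.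
exists (j, sup S); split => [q q01|c Sc q /andP[q0 q1]]; last first.
  by rewrite /line /= lerD2l ler_wpM2l ?subr_ge0 //; exact: ub_le_sup.
(* At 1 all lines of the family have the value j, so any one of them suffices; elsewhere the bound
   is solved for c by dividing by 1 - q. *)
have [->|q1] := eqVneq q 1.
  have := Sc1 1; rewrite /line /= subrr !mul0r; apply; lra.
have {}q1 : 0 < 1 - q by rewrite subr_gt0 lt_neqAle q1; case/andP: q01.
rewrite /line /= -lerBrDl mulrC -ler_pdivlMr //.
apply: ge_sup; first by exists c1.
move=> c /(_ q q01); rewrite /line /=.
by rewrite -lerBrDl mulrC -ler_pdivlMr.
Qed.

(** At an interior point the supporting line belongs to one of three families and lies below the
    best line of its family. At the endpoints [l.1] is unrestricted, but the supporting line there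
    is below [max3] on the open interval, and closure applies. *)
Lemma supporting_lines_max3 (R : realType) (W : R -> R) (j1 j2 j3 : R) :
  (forall p : R, 0 <= p <= 1 -> exists l : R * R,
    [/\ forall q : R, 0 <= q <= 1 -> line l q <= W q, line l p = W p &
        0 < p < 1 -> [\/ l.1 = j1, l.1 = j2 | l.1 = j3]]) ->
  exists l1 l2 l3, forall q : R, 0 <= q <= 1 -> W q = max3 l1 l2 l3 q.
Proof.
move=> H.
have [|l0 [l0W _ _]] := H 0; first by rewrite lexx ler01.
have [L1 [L1W L1m]] := best_line j1 l0W.
have [L2 [L2W L2m]] := best_line j2 l0W.
have [L3 [L3W L3m]] := best_line j3 l0W.
exists L1, L2, L3.
have leW q : 0 <= q <= 1 -> max3 L1 L2 L3 q <= W q.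
  by move=> q01; rewrite /max3 !ge_max L1W ?L2W ?L3W.
have int q : 0 < q < 1 -> W q <= max3 L1 L2 L3 q.
  move=> q01; have q01' : 0 <= q <= 1 by lra.
  have [[j c] [lW <- /(_ q01) /= jE]] := H q q01'.
  rewrite /max3 !le_max; case: jE => jE; subst j.
  - by rewrite L1m.
  - by rewrite (L2m c) ?orbT.
  - by rewrite (L3m c) ?orbT.
move=> q q01; apply/eqP; rewrite eq_le leW // andbT.
have [l [lW <- _]] := H q q01; apply: line_le_max3_closure => // p p01.
by apply: le_trans (int p p01); apply: lW; lra.
Qed.

(** The supporting line at the convex combination is affine and lies below [W] at both p and q. *)
Lemma supporting_lines_convex (R : realType) (W : R -> R) :
  (forall p : R, 0 <= p <= 1 -> exists l : R * R,
    (forall q : R, 0 <= q <= 1 -> line l q <= W q) /\ line l p = W p) ->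
  convex_function (`[0, 1]%classic : set R^o) (W : R^o -> R^o).
Proof.
move=> H t p q; rewrite !inE /= !in_itv /= => p01 q01.
rewrite [X in _ <= X]convRE [X in W X]convRE.
have t0 : 0 <= t%:num by [].
have t1 : t%:num <= 1 by [].
rewrite /unstable.onem; set r := t%:num in t0 t1 *.
case: (H (r * p + (1 - r) * q)) => [|l [lW <-]].
  by apply/andP; split; nra.
have := lW _ p01; have := lW _ q01.
have -> : line l (r * p + (1 - r) * q) = r * line l p + (1 - r) * line l q.
  by rewrite /line; ring.
by move=> h1 h2; rewrite lerD // ler_wpM2l // subr_ge0.
Qed.

(** * Finite transport problems: existence of an optimal plan *)

Definition plan (R : realType) (A B : finType) (mu : A -> R) (nu : B -> R)
    (pi : A -> B -> R) : Prop :=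
  [/\ forall a b, 0 <= pi a b, forall a, \sum_b pi a b = mu a
    & forall b, \sum_a pi a b = nu b].

Definition plan_cost (R : realType) (A B : finType) (c : A -> B -> R)
    (pi : A -> B -> R) : R := \sum_a \sum_b c a b * pi a b.

Lemma plan_le1 (R : realType) (A B : finType) (mu : A -> R) (nu : B -> R) pi :
  \sum_a mu a = 1 -> plan mu nu pi -> forall a b, pi a b <= 1.
Proof.
move=> mu1 [pi0 pimu _] a b.
rewrite -mu1 (bigD1 a) //= -pimu (bigD1 b) //= -addrA lerDl.
rewrite addr_ge0 ?sumr_ge0 // => a' _; rewrite -pimu sumr_ge0 //.
Qed.

Lemma linear_form_continuous (R : realType) (I : finType) (k : I -> R) :
  continuous ((fun f => \sum_i k i * f i) :
    prod_topology (fun _ : I => (R : topologicalType)) -> R).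
Proof.
apply: continuous_big => [x|i _ f]; first exact: add_continuous.
pose X := prod_topology (fun _ : I => (R : topologicalType)).
exact: (@continuous_comp X R R (fun g => g i) ( *%R (k i)) f
  (@proj_continuous I (fun=> (R : topologicalType)) i f)
  (@mulrl_continuous R (k i) (f i))).
Qed.

(** [P] is a closed subset of a cube, compact by Tychonoff, and the linear form is continuous for
    the product topology. *)
Lemma polytope_min (R : realType) (I T : finType) (e : T -> I -> R) (r : T -> R)
    (c f0 : I -> R) :
  let P := [set f : I -> R | (forall i, 0 <= f i <= 1) /\
                             (forall t, \sum_i e t i * f i = r t)] in
  P f0 -> exists2 f, P f & forall g, P g -> \sum_i c i * f i <= \sum_i c i * g i.
Proof.
move=> P Pf0; pose X := prod_topology (fun _ : I => (R : topologicalType)).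
have PE : P = [set f : X | forall i, (`[0, 1]%classic : set R) (f i)] `&`
    \bigcap_(t in [set: T]) ((fun f : X => \sum_i e t i * f i) @^-1` [set r t]).
  rewrite eqEsubset; split => f [f01 fr]; split => [i|t].
  - by rewrite /= in_itv; exact: f01.
  - by move=> _; exact: fr.
  - by have := f01 i; rewrite /= in_itv.
  - exact: fr.
have cP : @compact X P.
  rewrite PE; apply: compact_closedI.
    apply: (@tychonoff I (fun=> (R : topologicalType)) (fun=> `[0, 1]%classic)) => i.
    exact: segment_compact.
  apply: closed_bigI => t _; apply: preimage_closed; last exact: closed_eq.
  by move=> f _; exact: linear_form_continuous.
have [|f /set_mem Pf fmin] :=
    @compact_EVT_min X R (fun f => \sum_i c i * f i) P (ex_intro _ f0 Pf0) cP.
  by apply: continuous_subspaceT; exact: linear_form_continuous.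
by exists f => // g Pg; apply: fmin; rewrite inE.
Qed.

Lemma optimal_plan (R : realType) (A B : finType) (mu : A -> R) (nu : B -> R)
    (c : A -> B -> R) :
  (forall a, 0 <= mu a) -> (forall b, 0 <= nu b) ->
  \sum_a mu a = 1 -> \sum_b nu b = 1 ->
  exists2 pi, plan mu nu pi &
    forall pi', plan mu nu pi' -> plan_cost c pi <= plan_cost c pi'.
Proof.
move=> mu0 nu0 mu1 nu1.
(* The marginal conditions become one linear equation per element of [A + B]; the upper bound 1 on
   entries is automatic by [plan_le1]. *)
pose e (t : A + B) (i : A * B) : R :=
  match t with inl a => (i.1 == a)%:R | inr b => (i.2 == b)%:R end.
pose r (t : A + B) : R := match t with inl a => mu a | inr b => nu b end.
have rowE (f : A * B -> R) a : \sum_i (i.1 == a)%:R * f i = \sum_b f (a, b).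
  rewrite (eq_bigr (fun i => (i.1 == a)%:R * f (i.1, i.2))); last by case.
  rewrite -(pair_bigA _ (fun a' b => (a' == a)%:R * f (a', b))) /=.
  rewrite (bigD1 a) //= [X in _ + X]big1 ?addr0; last first.
    by move=> a' /negPf ->; rewrite big1 // => b _; rewrite mul0r.
  by apply: eq_bigr => b _; rewrite eqxx mul1r.
have colE (f : A * B -> R) b : \sum_i (i.2 == b)%:R * f i = \sum_a f (a, b).
  rewrite (eq_bigr (fun i => (i.2 == b)%:R * f (i.1, i.2))); last by case.
  rewrite -(pair_bigA _ (fun a b' => (b' == b)%:R * f (a, b'))) /=.
  apply: eq_bigr => a _; rewrite (bigD1 b) //= eqxx mul1r big1 ?addr0 //.
  by move=> b' /negPf ->; rewrite mul0r.
have planP pi : plan mu nu pi -> (forall i : A * B, 0 <= pi i.1 i.2 <= 1) /\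
    (forall t, \sum_i e t i * pi i.1 i.2 = r t).
  move=> pl; have [pi0 pimu pinu] := pl; split => [i|[a|b]].
  - by rewrite pi0 (plan_le1 mu1 pl).
  - by rewrite (rowE (fun i => pi i.1 i.2)); exact: pimu.
  - by rewrite (colE (fun i => pi i.1 i.2)); exact: pinu.
(* The product measure shows that the polytope is non-empty. *)
have pl0 : plan mu nu (fun a b => mu a * nu b).
  split => [a b|a|b]; first by rewrite mulr_ge0.
  - by rewrite -mulr_sumr nu1 mulr1.
  - by rewrite -mulr_suml mu1 mul1r.
have [f [f01 fr] fmin] := polytope_min (fun i => c i.1 i.2) (planP _ pl0).
exists (fun a b => f (a, b)).
  split => [a b|a|b]; first by case/andP: (f01 (a, b)).
  - by rewrite -rowE; exact: (fr (inl a)).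
  - by rewrite -colE; exact: (fr (inr b)).
move=> pi' /planP/fmin; rewrite /plan_cost !pair_bigA /= => h.
by rewrite (eq_bigr (fun i => c i.1 i.2 * f i)) //; case.
Qed.

(** * Signed flows and dual potentials *)

(** A unit of flow on one edge of the bipartite graph between [A] and [B]; signed sums of these
    build paths and cycles. *)
Definition delta (R : realType) (A B : finType) (a : A) (b : B) : A -> B -> R :=
  fun a' b' => ((a' == a) && (b' == b))%:R.

Lemma sum_delta_row (R : realType) (A B : finType) (a : A) (b : B) (a' : A) :
  \sum_b' delta R a b a' b' = (a' == a)%:R.
Proof.
rewrite /delta (bigD1 b) //= eqxx andbT big1 ?addr0 // => b' /negPf ->.
by rewrite andbF.
Qed.

Lemma sum_delta_col (R : realType) (A B : finType) (a : A) (b : B) (b' : B) :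
  \sum_a' delta R a b a' b' = (b' == b)%:R.
Proof.
by rewrite /delta (bigD1 a) //= eqxx big1 ?addr0 // => a' /negPf ->.
Qed.

Lemma plan_cost_delta (R : realType) (A B : finType) (c : A -> B -> R) a b :
  plan_cost c (delta R a b) = c a b.
Proof.
rewrite /plan_cost /delta (bigD1 a) //= (bigD1 b) //= !eqxx mulr1.
rewrite big1 => [|b' /negPf ->]; last by rewrite andbF mulr0.
rewrite big1 => [|a' /negPf ->]; first by rewrite !addr0.
by rewrite big1 // => b' _; rewrite mulr0.
Qed.

Lemma plan_costD (R : realType) (A B : finType) (c f g : A -> B -> R) (k : R) :
  plan_cost c (fun a b => f a b + k * g a b) =
  plan_cost c f + k * plan_cost c g.
Proof.
rewrite /plan_cost mulr_sumr -big_split; apply: eq_bigr => a _ /=.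
rewrite mulr_sumr -big_split; apply: eq_bigr => b _ /=; ring.
Qed.

(* [pi] can be perturbed by a small multiple of [f]. *)
Lemma circulation_cost_ge0 (R : realType) (A B : finType) (mu : A -> R)
    (nu : B -> R) (c pi f : A -> B -> R) :
  plan mu nu pi ->
  (forall pi', plan mu nu pi' -> plan_cost c pi <= plan_cost c pi') ->
  (forall a, \sum_b f a b = 0) -> (forall b, \sum_a f a b = 0) ->
  (forall a b, f a b < 0 -> 0 < pi a b) ->
  0 <= plan_cost c f.
Proof.
move=> [pi0 pimu pinu] opt frow fcol fneg.
(* [M] dominates every ratio of [f] to [pi], so a step of size 1 / M keeps the plan non-negative.
   Where [pi] vanishes the ratio is 0 by convention, and there [f] is non-negative. *)
pose M := 1 + \sum_a \sum_b `|f a b| / pi a b.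
have q0 a b : 0 <= `|f a b| / pi a b by rewrite divr_ge0.
have M0 : 0 < M.
  by rewrite ltr_pwDl // sumr_ge0 // => a _; rewrite sumr_ge0.
have leM a b : `|f a b| / pi a b <= M.
  rewrite /M (bigD1 a) //= (bigD1 b) //=.
  set x := `|_| / _; set S := \sum_(i | i != b) _; set T := \sum_(i | i != a) _.
  have S0 : 0 <= S by apply: sumr_ge0.
  have T0 : 0 <= T by apply: sumr_ge0 => a' _; apply: sumr_ge0.
  lra.
have : plan mu nu (fun a b => pi a b + M^-1 * f a b).
  split => [a b|a|b].
  - have [f0|f0] := leP 0 (f a b).
      by rewrite addr_ge0 // mulr_ge0 // invr_ge0 ltW.
    have := leM a b; rewrite ler_pdivrMr ?fneg // (ltr0_norm f0) => h.
    rewrite mulrC -[f a b]opprK mulNr subr_ge0 ler_pdivrMr // mulrC; lra.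
  - by rewrite big_split /= -mulr_sumr frow mulr0 addr0.
  - by rewrite big_split /= -mulr_sumr fcol mulr0 addr0.
move=> /opt; rewrite plan_costD lerDl pmulr_rge0 // invr_gt0 //.
Qed.

Lemma fin_argmin (R : realType) (T : finType) (P : pred T) (h : T -> R) (t0 : T) :
  P t0 -> exists2 t, P t & forall t', P t' -> h t <= h t'.
Proof. by move=> Pt0; case: (arg_minP h Pt0) => t Pt ht; exists t. Qed.

(* The potential of a column is its distance from a row [s] of positive mass in
   the residual network of [pi], a "path" being a signed unit flow; it is finite
   only for columns of positive mass, and is transferred to all rows, then to all
   columns, by two c-transforms. *)
Lemma optimal_plan_potentials (R : realType) (A B : finType) (mu : A -> R)
    (nu : B -> R) (c pi : A -> B -> R) :
  \sum_a mu a = 1 -> plan mu nu pi ->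
  (forall pi', plan mu nu pi' -> plan_cost c pi <= plan_cost c pi') ->
  exists (u : A -> R) (v : B -> R), (forall a b, u a + v b <= c a b) /\
    (forall a b, 0 < pi a b -> u a + v b = c a b).
Proof.
move=> mu1 pl opt; have [pi0 pimu pinu] := pl.
have [s [b0 sb0]] : exists s b, 0 < pi s b.
  apply: contrapT => npos; suff : \sum_a mu a = 0 by rewrite mu1 => /eqP; rewrite oner_eq0.
  rewrite big1 // => a _; rewrite -pimu big1 // => b _; apply/eqP.
  rewrite eq_le pi0 andbT leNgt; apply/negP => ab; apply: npos; by exists a, b.
(* Signed unit flows from row [s] to column b that remove mass only where [pi] has some. *)
pose F b := [set f : A -> B -> R | [/\ forall a, \sum_b f a b = (a == s)%:R,
  forall b', \sum_a f a b' = (b' == b)%:R &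
  forall a b', f a b' < 0 -> 0 < pi a b']].
pose C b := [set plan_cost c f | f in F b].
pose pos := [pred b | [exists a, 0 < pi a b]].
have C0 b : C b !=set0.
  exists (c s b), (delta R s b); last exact: plan_cost_delta.
  split => [a|b'|a b']; [exact: sum_delta_row|exact: sum_delta_col|].
  by rewrite /delta ltNge ler0n.
(* A flow ending at b is extended to b2 by going back along the edge (a, b) and forward along (a,
   b2). *)
have shift f b a b2 : 0 < pi a b -> F b f ->
    F b2 (fun a' b' => (f a' b' + -1 * delta R a b a' b') + 1 * delta R a b2 a' b').
  move=> ab [frow fcol fneg]; split => [a'|b'|a' b'].
  - by rewrite !big_split /= -!mulr_sumr frow !sum_delta_row; ring.
  - by rewrite !big_split /= -!mulr_sumr fcol !sum_delta_col; ring.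
  - have [/andP[/eqP -> /eqP ->] //|ne] := boolP ((a' == a) && (b' == b)).
    rewrite /delta (negPf ne) mulr0 addr0 mul1r => h; apply: fneg.
    by apply: le_lt_trans h; rewrite lerDl ler0n.
(* Extended to [b0] and closed up through the positive entry (s, b0), a flow becomes a circulation,
   whose cost is non-negative by optimality. *)
have lbC b : pos b -> has_lbound (C b).
  move=> /existsP[a0 a0b].
  exists (c a0 b - c a0 b0 + c s b0) => _ [f Ff <-].
  have [hrow hcol hneg] := shift f b a0 b0 a0b Ff.
  have := circulation_cost_ge0 (f := (fun a' b' =>
    ((f a' b' + -1 * delta R a0 b a' b') + 1 * delta R a0 b0 a' b')
    + -1 * delta R s b0 a' b')) pl opt.
  rewrite !plan_costD !plan_cost_delta => h.
  suff : 0 <= plan_cost c f + -1 * c a0 b + 1 * c a0 b0 + -1 * c s b0 by lra.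
  apply: h => [a|b'|a b'].
  - by rewrite big_split /= -mulr_sumr hrow sum_delta_row; ring.
  - by rewrite big_split /= -mulr_sumr hcol sum_delta_col; ring.
  - have [/andP[/eqP -> /eqP ->] //|ne] := boolP ((a == s) && (b' == b0)).
    rewrite {3}/delta (negPf ne) mulr0 addr0; exact: hneg.
pose g b := inf (C b).
(* The infimum over flows inherits the extension step: a column matched with a minimises
   [c a b - g b] among positive columns. *)
have gstep a b b2 : 0 < pi a b -> pos b2 -> c a b - g b <= c a b2 - g b2.
  move=> ab pb2; suff : g b2 + c a b - c a b2 <= g b by lra.
  apply: lb_le_inf => // _ [f Ff <-].
  have : g b2 <= plan_cost c (fun a' b' =>
      (f a' b' + -1 * delta R a b a' b') + 1 * delta R a b2 a' b').
    by apply: ge_inf; [exact: lbC|eexists; [exact: shift ab Ff|]].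
  rewrite !plan_costD !plan_cost_delta; lra.
have posb0 : pos b0 by apply/existsP; exists s.
have /choice[u uP] a : exists ua, (exists2 b, pos b & ua = c a b - g b) /\
    forall b, pos b -> ua <= c a b - g b.
  have [b pb hb] := fin_argmin (fun b => c a b - g b) posb0.
  by exists (c a b - g b); split => //; exists b.
have /choice[v vP] b : exists vb, (exists a, vb = c a b - u a) /\
    forall a, vb <= c a b - u a.
  have [a _ ha] := fin_argmin (P := predT) (fun a => c a b - u a) (t0 := s) isT.
  by exists (c a b - u a); split => [|a']; [exists a|exact: ha].
exists u, v; split => [a b|a b ab].
  by have := (vP b).2 a; lra.
have pb : pos b by apply/existsP; exists a.
(* By [gstep], u a >= c a b - g b. The choice of u at the row a1 attaining v b gives v b >= g b.
   Feasibility then forces equality. *)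
have [[b1 pb1 ub1] umin] := uP a; have [[a1 va1] vmin] := vP b.
have := (uP a1).2 b pb; have := gstep _ _ _ ab pb1; have := vmin a; have := umin b pb.
lra.
Qed.

(** * Integral duality and complementary slackness *)

(* Rounding [u] down and [v] up keeps every constraint, and every equality, because
   the costs are integers. *)
Lemma integral_potentials (R : realType) (A B : finType) (c : A -> B -> nat)
    (u : A -> R) (v : B -> R) (E : A -> B -> Prop) :
  (forall a b, u a + v b <= (c a b)%:R) -> (forall a b, E a b -> u a + v b = (c a b)%:R) ->
  exists (u' : A -> int) (v' : B -> int),
    (forall a b, u' a + v' b <= (c a b)%:Z) /\
    (forall a b, E a b -> u' a + v' b = (c a b)%:Z).
Proof.
move=> uv uvE; exists (fun a => Num.floor (u a)), (fun b => - Num.floor (- v b)).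
have le a b : Num.floor (u a) - Num.floor (- v b) <= (c a b)%:Z.
  rewrite lerBlDr -lerBlDl floor_ge_int intrB.
  by have := floor_le (u a); have := uv a b; rewrite -[_%:Z%:~R]/(_%:R); lra.
split=> // a b /uvE e; apply/eqP; rewrite eq_le le /=.
rewrite lerBrDr floor_ge_int intrD.
by have := floor_le (- v b); rewrite -[_%:Z%:~R]/(_%:R); lra.
Qed.

(** Optimality of [pi] is recorded through complementary slackness, which implies it by weak
    duality. *)
Lemma integral_duality (R : realType) (A B : finType) (mu : A -> R)
    (nu : B -> R) (c : A -> B -> nat) :
  (forall a, 0 <= mu a) -> (forall b, 0 <= nu b) ->
  \sum_a mu a = 1 -> \sum_b nu b = 1 ->
  exists (pi : A -> B -> R) (u : A -> int) (v : B -> int),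
    [/\ plan mu nu pi, forall a b, u a + v b <= (c a b)%:Z &
        forall a b, 0 < pi a b -> u a + v b = (c a b)%:Z].
Proof.
move=> mu0 nu0 mu1 nu1.
have [pi pl opt] := optimal_plan (fun a b => (c a b)%:R) mu0 nu0 mu1 nu1.
have [u [v [uv uvE]]] := optimal_plan_potentials mu1 pl opt.
have [u' [v' [uv' uvE']]] := integral_potentials uv uvE.
by exists pi, u', v'; split.
Qed.

(** Weak duality: both dual sums are expanded through the marginals of [pi] and compared with the
    cost term by term. *)
Lemma dual_le_plan_cost (R : realType) (A B : finType) (mu : A -> R)
    (nu : B -> R) (c : A -> B -> R) (pi : A -> B -> R) (u : A -> R) (v : B -> R) :
  plan mu nu pi -> (forall a b, u a + v b <= c a b) ->
  \sum_a u a * mu a + \sum_b v b * nu b <= plan_cost c pi.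
Proof.
move=> [pi0 pimu pinu] uv.
rewrite (eq_bigr (fun a => \sum_b u a * pi a b)); last first.
  by move=> a _; rewrite -pimu mulr_sumr.
rewrite [X in _ + X](eq_bigr (fun b => \sum_a v b * pi a b)); last first.
  by move=> b _; rewrite -pinu mulr_sumr.
rewrite [X in _ + X]exchange_big -big_split; apply: ler_sum => a _ /=.
rewrite -big_split; apply: ler_sum => b _ /=.
by rewrite -mulrDl ler_wpM2r.
Qed.

Lemma dual_eq_plan_cost (R : realType) (A B : finType) (mu : A -> R)
    (nu : B -> R) (c : A -> B -> R) (pi : A -> B -> R) (u : A -> R) (v : B -> R) :
  plan mu nu pi -> (forall a b, 0 < pi a b -> u a + v b = c a b) ->
  plan_cost c pi = \sum_a u a * mu a + \sum_b v b * nu b.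
Proof.
move=> [pi0 pimu pinu] uv.
rewrite (eq_bigr (fun a => \sum_b u a * pi a b)); last first.
  by move=> a _; rewrite -pimu mulr_sumr.
rewrite [X in _ + X](eq_bigr (fun b => \sum_a v b * pi a b)); last first.
  by move=> b _; rewrite -pinu mulr_sumr.
rewrite [X in _ + X]exchange_big -big_split; apply: eq_bigr => a _ /=.
rewrite -big_split; apply: eq_bigr => b _ /=; rewrite -mulrDl.
have := pi0 a b; rewrite le_eqVlt => /orP[/eqP <-|/uv -> //].
by rewrite !mulr0.
Qed.

Lemma plan_row_pos (R : realType) (A B : finType) (mu : A -> R) (nu : B -> R) pi a :
  plan mu nu pi -> 0 < mu a -> exists b, 0 < pi a b.
Proof.
move=> [pi0 pimu _]; rewrite -pimu => h; apply: contrapT => npos.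
move: h; rewrite big1 ?ltxx // => b _; apply/eqP.
by rewrite eq_le pi0 andbT leNgt; apply/negP => ab; apply: npos; exists b.
Qed.

Lemma plan_col_pos (R : realType) (A B : finType) (mu : A -> R) (nu : B -> R) pi b :
  plan mu nu pi -> 0 < nu b -> exists a, 0 < pi a b.
Proof.
move=> [pi0 _ pinu]; rewrite -pinu => h; apply: contrapT => npos.
move: h; rewrite big1 ?ltxx // => a _; apply/eqP.
by rewrite eq_le pi0 andbT leNgt; apply/negP => ab; apply: npos; exists a.
Qed.

(** * Couplings on V reduced to plans between finite supports *)

Lemma esum_fset_support (R : realType) (V : choiceType) (S : {fset V}) (f : V -> \bar R) :
  (forall v, 0 <= f v)%E -> (forall v, v \notin S -> f v = 0%E) ->
  (\esum_(v in [set: V]) f v = \sum_(a : S) f (val a))%E.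
Proof.
move=> f0 fS; transitivity (\esum_(v in [set` S]) f v)%E.
  rewrite [RHS]esum_mkcond; apply: eq_esum => v _.
  by case: ifPn => //; rewrite mem_setE => /fS.
by rewrite esum_fset // fsbig_finite // set_fsetK big_seq_fsetE.
Qed.

Lemma esum_eq0_inv (R : realType) (V : choiceType) (f : V -> \bar R) v :
  (forall v, 0 <= f v)%E -> (\esum_(v in [set: V]) f v = 0)%E -> f v = 0%E.
Proof.
move=> f0 e; apply/eqP; rewrite eq_le f0 andbT -e.
by apply: esum_ge; exists [set v]; [split | rewrite fsbig_set1].
Qed.

(** A vanishing sum of non-negative terms kills each term, so a coupling is carried by the product
    of the supports. *)
Lemma coupling_restrict (R : realType) (V : choiceType) (S T : {fset V})
    (m1 m2 : V -> R) (pi : V -> V -> R) :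
  (forall v, v \notin S -> m1 v = 0) -> (forall v, v \notin T -> m2 v = 0) ->
  coupling m1 m2 pi ->
  (forall v w, v \notin S \/ w \notin T -> pi v w = 0) /\
  plan (A := S) (B := T) (m1 \o val) (m2 \o val) (fun a b => pi (val a) (val b)).
Proof.
move=> m1S m2T [pi01 pi1 pi2].
have pi0 v w : (0 <= (pi v w)%:E)%E by rewrite lee_fin; case/andP: (pi01 v w).
have supp v w : v \notin S \/ w \notin T -> pi v w = 0.
  move=> [vS|wT]; apply: EFin_inj.
    by apply: (esum_eq0_inv (f := fun w => (pi v w)%:E)) => //; rewrite pi1 m1S.
  by apply: (esum_eq0_inv (f := fun v => (pi v w)%:E)) => //; rewrite pi2 m2T.
split=> //; split=> [a b|a|b]; first by case/andP: (pi01 (val a) (val b)).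
  apply: EFin_inj; rewrite -[RHS]pi1 (esum_fset_support (S := T)) //.
    by rewrite sumEFin.
  by move=> w wT; rewrite supp //; right.
apply: EFin_inj; rewrite -[RHS]pi2 (esum_fset_support (S := S)) //.
  by rewrite sumEFin.
by move=> w wT; rewrite supp //; left.
Qed.

Definition extend0 (R : realType) (V : choiceType) (S T : {fset V})
    (pi : S -> T -> R) (v w : V) : R :=
  if insub v is Some a then if insub w is Some b then pi a b else 0 else 0.

Lemma extend0_val (R : realType) (V : choiceType) (S T : {fset V})
    (pi : S -> T -> R) a b : extend0 pi (val a) (val b) = pi a b.
Proof. by rewrite /extend0 !valK. Qed.

Lemma extend0_out (R : realType) (V : choiceType) (S T : {fset V})
    (pi : S -> T -> R) v w :
  v \notin S \/ w \notin T -> extend0 pi v w = 0.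
Proof.
rewrite /extend0 => -[h|h]; first by rewrite insubN.
by case: insub => // a; rewrite insubN.
Qed.

Lemma coupling_extend0 (R : realType) (V : choiceType) (S T : {fset V})
    (m1 m2 : V -> R) (pi : S -> T -> R) :
  (forall v, v \notin S -> m1 v = 0) -> (forall v, v \notin T -> m2 v = 0) ->
  \sum_(a : S) m1 (val a) = 1 ->
  plan (m1 \o val) (m2 \o val) pi -> coupling m1 m2 (extend0 pi).
Proof.
move=> m1S m2T m11 pl; have [pi0 pi1 pi2] := pl.
have e01 v w : 0 <= extend0 pi v w <= 1.
  rewrite /extend0; case: insub => [a|]; last by rewrite lexx ler01.
  case: insub => [b|]; last by rewrite lexx ler01.
  by rewrite pi0 (plan_le1 m11 pl).
have e0 v w : (0 <= (extend0 pi v w)%:E)%E.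
  by rewrite lee_fin; case/andP: (e01 v w).
split=> // [v|w].
  rewrite (esum_fset_support (S := T)) //; last first.
    by move=> w wT; rewrite extend0_out //; right.
  rewrite sumEFin; congr EFin.
  have [vS|vS] := boolP (v \in S); last first.
    by rewrite m1S // big1 // => b _; rewrite extend0_out //; left.
  rewrite -[v]/(val [` vS]%fset) -[RHS]pi1.
  by apply: eq_bigr => b _; rewrite extend0_val.
rewrite (esum_fset_support (S := S)) //; last first.
  by move=> v vS; rewrite extend0_out //; left.
rewrite sumEFin; congr EFin.
have [wT|wT] := boolP (w \in T); last first.
  by rewrite m2T // big1 // => b _; rewrite extend0_out //; right.
rewrite -[w]/(val [` wT]%fset) -[RHS]pi2.
by apply: eq_bigr => a _; rewrite extend0_val.
Qed.

(** * Paths and the integer-valued graph distance *)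

Definition joined (V : choiceType) (G : simple_graph V) (v w : V) : Prop :=
  exists s, path (adj G) v s /\ last v s = w.

(** Natural-valued, as integral duality requires. It is faithful only for joined vertices, an
    infinite distance being sent to 0. *)
Definition dist (R : realType) (V : choiceType) (G : simple_graph V) (v w : V) : nat :=
  Num.truncn (fine (gdist R G v w)).

Arguments dist R {V} G v w.

(** Lengths are natural numbers, so the infimum is attained by a shortest path. *)
Lemma gdist_path (R : realType) (V : choiceType) (G : simple_graph V) v w :
  joined G v w -> exists s, [/\ path (adj G) v s, last v s = w,
    gdist R G v w = (size s)%:R%:E &
    forall s', path (adj G) v s' -> last v s' = w -> (size s <= size s')%N].
Proof.
move=> [s0 [ps0 ls0]].
pose P n := `[< exists s, [/\ path (adj G) v s, last v s = w & size s = n] >].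
have exP : exists n, P n by exists (size s0); apply/asboolP; exists s0.
case: (ex_minnP exP) => n /asboolP[s [ps ls sn]] nmin.
have smin s' : path (adj G) v s' -> last v s' = w -> (size s <= size s')%N.
  by move=> ps' ls'; rewrite sn; apply: nmin; apply/asboolP; exists s'.
exists s; split=> //; apply/eqP; rewrite eq_le; apply/andP; split.
  by apply: ereal_inf_lbound; exists s.
by apply: le_ereal_inf_tmp => _ [s' [ps' ls'] <-]; rewrite lee_fin ler_nat smin.
Qed.

Lemma gdist_fin_joined (R : realType) (V : choiceType) (G : simple_graph V) v w (d : R) :
  gdist R G v w = d%:E -> joined G v w.
Proof.
move=> h; apply: contrapT => nj; move: h; rewrite /gdist.
rewrite (_ : [set s | _] = set0) ?image_set0 ?ereal_inf0 //.
by apply/seteqP; split => // s /= hs; apply: nj; exists s.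
Qed.

Lemma gdistE (R : realType) (V : choiceType) (G : simple_graph V) v w :
  joined G v w -> gdist R G v w = (dist R G v w)%:R%:E.
Proof. by move=> /(gdist_path R)[s [_ _ e _]]; rewrite /dist e /= natrK. Qed.

Lemma dist_adjr (R : realType) (V : choiceType) (G : simple_graph V) v w w' :
  joined G v w -> adj G w w' -> (dist R G v w' <= (dist R G v w).+1)%N.
Proof.
move=> jvw ww'; have [s [ps ls es _]] := gdist_path R jvw.
have ps' : path (adj G) v (rcons s w') by rewrite rcons_path ps ls ww'.
have [|s' [_ _ es' /(_ _ ps')]] := @gdist_path R V G v w'.
  by exists (rcons s w'); rewrite last_rcons.
by rewrite /dist es es' /= !natrK size_rcons last_rcons => ->.
Qed.

Lemma joined_adjr (V : choiceType) (G : simple_graph V) v w w' :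
  joined G v w -> adj G w w' -> joined G v w'.
Proof.
move=> [s [ps ls]] ww'; exists (rcons s w').
by rewrite rcons_path last_rcons ps ls ww'.
Qed.

Lemma joined_adjl (V : choiceType) (G : simple_graph V) v v' w :
  joined G v w -> adj G v' v -> joined G v' w.
Proof. by move=> [s [ps ls]] vv'; exists (v :: s); rewrite /= vv'. Qed.

(** * Duality for the Wasserstein distance *)

Lemma cost_restrict (R : realType) (V : choiceType) (G : simple_graph V)
    (S T : {fset V}) (pi : V -> V -> R) :
  (forall v w, v \in S -> w \in T -> joined G v w) ->
  (forall v w, 0 <= pi v w) ->
  (forall v w, v \notin S \/ w \notin T -> pi v w = 0) ->
  cost G pi = (plan_cost (A := S) (B := T) (fun a b => (dist R G (val a) (val b))%:R)
    (fun a b => pi (val a) (val b)))%:E.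
Proof.
move=> J pi0 supp.
have t0 v w : (0 <= gdist R G v w * (pi v w)%:E)%E.
  rewrite mule_ge0 ?lee_fin //; apply: le_ereal_inf_tmp => _ [s _ <-].
  by rewrite lee_fin.
rewrite /cost (esum_fset_support (S := S)); last 2 first.
- by move=> v; apply: esum_ge0 => w _.
- move=> v vS; apply: esum1 => w _; rewrite supp ?mule0 //; by left.
rewrite /plan_cost -sumEFin; apply: eq_bigr => a _.
rewrite (esum_fset_support (S := T)) //; last first.
  by move=> w wT; rewrite supp ?mule0 //; right.
rewrite -sumEFin; apply: eq_bigr => b _.
by rewrite gdistE ?EFinM //; apply: J; exact: valP.
Qed.

(** Slackness is kept only in the form used later: each vertex of positive mass lies in some tight
    pair. *)
Lemma W1_duality (R : realType) (V : choiceType) (G : simple_graph V)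
    (S T : {fset V}) (m1 m2 : V -> R) :
  (forall v w, v \in S -> w \in T -> joined G v w) ->
  (forall v, 0 <= m1 v) -> (forall v, 0 <= m2 v) ->
  (forall v, v \notin S -> m1 v = 0) -> (forall v, v \notin T -> m2 v = 0) ->
  \sum_(a : S) m1 (val a) = 1 -> \sum_(b : T) m2 (val b) = 1 ->
  exists (u : S -> int) (v : T -> int),
    [/\ forall a b, u a + v b <= (dist R G (val a) (val b))%:Z,
      W1 G m1 m2 = (\sum_a (u a)%:~R * m1 (val a) + \sum_b (v b)%:~R * m2 (val b))%:E,
      forall a, 0 < m1 (val a) -> exists b, u a + v b = (dist R G (val a) (val b))%:Z &
      forall b, 0 < m2 (val b) -> exists a, u a + v b = (dist R G (val a) (val b))%:Z].
Proof.
move=> J m10 m20 m1S m2T m11 m21.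
have [pi [u [v [pl uv uvE]]]] := integral_duality (A := S) (B := T) (mu := m1 \o val) (nu := m2 \o val)
  (fun a b => dist R G (val a) (val b)) (fun a => m10 (val a))
  (fun b => m20 (val b)) m11 m21.
have uvR a b : (u a)%:~R + (v b)%:~R <= (dist R G (val a) (val b))%:R :> R.
  by rewrite -intrD -[leRHS]/((dist R G (val a) (val b))%:Z%:~R) ler_int.
have uvER a b : 0 < pi a b ->
    (u a)%:~R + (v b)%:~R = (dist R G (val a) (val b))%:R :> R.
  by move=> /uvE e; rewrite -intrD e.
exists u, v; split=> // [|a /(plan_row_pos pl)[b ab]|
    b /(plan_col_pos pl)[a ab]]; [|by exists b; rewrite uvE|by exists a; rewrite uvE].
have costE pi' : coupling m1 m2 pi' -> cost G pi' =
    (plan_cost (A := S) (B := T) (fun a b => (dist R G (val a) (val b))%:R)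
      (fun a b => pi' (val a) (val b)))%:E.
  move=> cpl; have [supp _] := coupling_restrict m1S m2T cpl.
  apply: cost_restrict => // x y; by have [/(_ x y)/andP[]] := cpl.
apply/eqP; rewrite eq_le; apply/andP; split.
  have cpl := coupling_extend0 m1S m2T m11 pl.
  rewrite -(dual_eq_plan_cost pl uvER).
  apply: ereal_inf_lbound; exists (extend0 pi) => //.
  rewrite (costE _ cpl); congr EFin; rewrite /plan_cost.
  by apply: eq_bigr => a _; apply: eq_bigr => b _; rewrite extend0_val.
apply: le_ereal_inf_tmp => _ [pi' cpl <-]; rewrite (costE _ cpl) lee_fin.
have [_ pl'] := coupling_restrict m1S m2T cpl.
exact: dual_le_plan_cost pl' uvR.
Qed.

(** The constraint on the potentials does not involve the measures, so potentials optimal for one p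
    bound [W1] from below for every other. *)
Lemma dual_le_W1 (R : realType) (V : choiceType) (G : simple_graph V)
    (S T : {fset V}) (m1 m2 : V -> R) (u : S -> R) (v : T -> R) :
  (forall v w, v \in S -> w \in T -> joined G v w) ->
  (forall v, v \notin S -> m1 v = 0) -> (forall v, v \notin T -> m2 v = 0) ->
  (forall a b, u a + v b <= (dist R G (val a) (val b))%:R) ->
  ((\sum_a u a * m1 (val a) + \sum_b v b * m2 (val b))%:E <= W1 G m1 m2)%E.
Proof.
move=> J m1S m2T uv; apply: le_ereal_inf_tmp => _ [pi cpl <-].
have [supp pl] := coupling_restrict m1S m2T cpl.
rewrite (cost_restrict (S := S) (T := T)) // ?lee_fin; first exact: dual_le_plan_cost pl uv.
by move=> x y; have [/(_ x y)/andP[]] := cpl.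
Qed.

(** * The measures [mu] on balls of radius one *)

Definition ball1 (V : choiceType) (G : simple_graph V) (v : V) : {fset V} :=
  (v |` fset_set (neighbors G v))%fset.

Lemma in_ball1 (V : choiceType) (G : simple_graph V) v z : locally_finite G ->
  (z \in ball1 G v) = (z == v) || adj G v z.
Proof.
move=> Gfin; rewrite in_fset1U in_fset_set; last exact: Gfin.
by congr (_ || _); apply/idP/idP; rewrite inE.
Qed.

Lemma ball1_center (V : choiceType) (G : simple_graph V) v : v \in ball1 G v.
Proof. by rewrite in_fset1U eqxx. Qed.

Definition center (V : choiceType) (G : simple_graph V) v : ball1 G v :=
  [` ball1_center G v]%fset.

Lemma card_ball1 (V : choiceType) (G : simple_graph V) v : locally_finite G ->
  #|{: ball1 G v}| = (deg G v).+1.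
Proof.
move=> Gfin; rewrite -cardfE /ball1 cardfsU1 in_fset_set; last exact: Gfin.
suff -> : v \notin neighbors G v by [].
by apply/negP; rewrite inE /neighbors /= adj_irr.
Qed.

(** This makes the dual value affine in p: the center has weight p and each neighbor a weight
    proportional to 1 - p. *)
Lemma sum_mu_ball1 (R : realType) (V : choiceType) (G : simple_graph V) v p
    (u : ball1 G v -> R) : locally_finite G ->
  \sum_a u a * mu G p v (val a) =
  p * u (center G v) +
  (1 - p) * (\sum_(a | a != center G v) u a / (deg G v)%:R).
Proof.
move=> Gfin; rewrite (bigD1 (center G v)) //= {1}/mu eqxx mulrC; congr (_ + _).
rewrite mulr_sumr; apply: eq_bigr => a ne.
rewrite /mu -[v in val a == v]/(val (center G v)) (inj_eq val_inj) (negPf ne).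
have := valP a; rewrite in_ball1 // -[v in val a == v]/(val (center G v)).
by rewrite (inj_eq val_inj) (negPf ne) /= => ->; ring.
Qed.

(** At an isolated vertex the share 1 - p of the neighbors would be lost, hence the condition on the
    degree. *)
Lemma sum_mu1 (R : realType) (V : choiceType) (G : simple_graph V) v (p : R) :
  locally_finite G -> (0 < deg G v)%N -> \sum_(a : ball1 G v) mu G p v (val a) = 1.
Proof.
move=> Gfin d0; under eq_bigr do rewrite -[mu _ _ _ _]mul1r.
rewrite (sum_mu_ball1 p (fun _ : ball1 G v => 1)) // -mulr_suml sumr_const.
have -> : #|[pred a | a != center G v]| = deg G v.
  by have := cardC1 (center G v); rewrite card_ball1 //= => <-.
by rewrite divff ?pnatr_eq0 -?lt0n //; ring.
Qed.

Lemma mu_ge0 (R : realType) (V : choiceType) (G : simple_graph V) v z (p : R) :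
  0 <= p <= 1 -> 0 <= mu G p v z.
Proof.
move=> /andP[p0 p1]; rewrite /mu; case: ifP => // _; case: ifP => // _.
by rewrite divr_ge0 // subr_ge0.
Qed.

Lemma mu_out (R : realType) (V : choiceType) (G : simple_graph V) v z (p : R) :
  locally_finite G -> z \notin ball1 G v -> mu G p v z = 0.
Proof. by move=> Gfin; rewrite in_ball1 // /mu negb_or => /andP[/negPf -> /negPf ->]. Qed.

Lemma deg_gt0 (V : choiceType) (G : simple_graph V) v w :
  locally_finite G -> adj G v w -> (0 < deg G v)%N.
Proof.
move=> Gfin vw; rewrite /deg cardfs_gt0; apply/fset0Pn; exists w.
by rewrite in_fset_set ?inE //; exact: Gfin.
Qed.

(** A path between distinct vertices has a first and a last edge. *)
Lemma joined_deg (V : choiceType) (G : simple_graph V) v w : locally_finite G ->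
  joined G v w -> v != w -> (0 < deg G v)%N /\ (0 < deg G w)%N.
Proof.
move=> Gfin [s [ps ls]] ne; split.
  case: s ps ls => [_ /= e|z s /= /andP[vz _] _]; first by rewrite e eqxx in ne.
  exact: deg_gt0 vz.
case/lastP: s ps ls => [_ /= e|s z]; first by rewrite e eqxx in ne.
rewrite rcons_path last_rcons => /andP[_ ls] <-.
by apply: (deg_gt0 (w := last v s)) => //; rewrite adj_sym.
Qed.

Lemma mu_center (R : realType) (V : choiceType) (G : simple_graph V) v (p : R) :
  mu G p v (val (center G v)) = p.
Proof. by rewrite /mu eqxx. Qed.

(** * Supporting lines of the Wasserstein distance, and the curvature *)

(** The line is the dual value, as q varies, of integer potentials optimal at p. *)
Lemma W1_supporting_lines (R : realType) (V : choiceType) (G : simple_graph V)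
    (x y : V) (d : nat) : locally_finite G -> gdist R G x y = (d%:R)%:E ->
  (2 <= d)%N ->
  let W (q : R) := fine (W1 G (mu G q x) (mu G q y)) in
  forall p : R, 0 <= p <= 1 -> exists l : R * R,
    [/\ forall q : R, 0 <= q <= 1 -> line l q <= W q, line l p = W p &
        0 < p < 1 -> [\/ l.1 = d%:R - 2, l.1 = d%:R - 1 | l.1 = d%:R]].
Proof.
move=> Gfin dxy d2 W.
have jxy : joined G x y := gdist_fin_joined dxy.
have distxy : dist R G x y = d by rewrite /dist dxy /= natrK.
have nexy : x != y.
  apply/eqP => e; move: d2; rewrite -distxy; subst y.
  have [s [_ _ es /(_ [::] isT erefl)]] := gdist_path R jxy.
  by rewrite /dist es /= natrK; case: s es.
have [dx dy] := joined_deg Gfin jxy nexy.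
pose A := ball1 G x; pose B := ball1 G y.
have J v w : v \in A -> w \in B -> joined G v w.
  rewrite !in_ball1 // => hv hw; have {hv} jvy : joined G v y.
    case/orP: hv => [/eqP -> //|xv]; apply: joined_adjl jxy _.
    by rewrite adj_sym.
  by case/orP: hw => [/eqP -> //|yw]; apply: joined_adjr jvy yw.
(* The balls [A] and [B] do not depend on q, so potentials found at p can be tested at q. *)
have dual (q : R) (q01 : 0 <= q <= 1) := W1_duality J
  (fun z => mu_ge0 G x z q01) (fun z => mu_ge0 G y z q01)
  (fun z => mu_out q Gfin) (fun z => mu_out q Gfin)
  (sum_mu1 q Gfin dx) (sum_mu1 q Gfin dy).
move=> p p01; have [u [v [uv WE rowE colE]]] := dual p p01.
pose cx : A := center G x; pose cy : B := center G y.
pose l : R * R := ((u cx + v cy)%:~R,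
  \sum_(a | a != cx) (u a)%:~R / (deg G x)%:R + \sum_(b | b != cy) (v b)%:~R / (deg G y)%:R).
have lE q : line l q = \sum_a (u a)%:~R * mu G q x (val a) +
    \sum_b (v b)%:~R * mu G q y (val b).
  rewrite (sum_mu_ball1 q (fun a : A => (u a)%:~R)) //.
  rewrite (sum_mu_ball1 q (fun b : B => (v b)%:~R)) //.
  by rewrite /line /= intrD -/cx -/cy; ring.
exists l; split=> [q q01||/andP[p0 p1]].
(* Duality at q serves only to show that [W1] is finite there, so that [fine] can be removed. *)
- have [u' [v' [_ WE' _ _]]] := dual q q01.
  rewrite -lee_fin /W fineK ?WE' // -WE' lE.
  apply: dual_le_W1 => // [z|z|a b]; [exact: mu_out|exact: mu_out|].
  by rewrite -intrD -[leRHS]/((dist R G (val a) (val b))%:Z%:~R) ler_int.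
- by rewrite /W WE /= lE.
- have [z ez] : exists z, u cx + v z = (dist R G x (val z))%:Z.
    by apply: (rowE cx); rewrite mu_center.
  have [a ea] : exists a, u a + v cy = (dist R G (val a) y)%:Z.
    by apply: (colE cy); rewrite mu_center.
  have : adj G y (val z) \/ val z = y.
    by have := valP z; rewrite in_ball1 // => /orP[/eqP|]; [right|left].
  have ay := J _ _ (valP a) (ball1_center G y).
  have xz := J _ _ (ball1_center G x) (valP z).
  have := uv a z; have := uv cx cy; rewrite [val cx]/= [val cy]/= distxy => h1 h2 hz.
  have hx : (d <= (dist R G x (val z)).+1)%N.
    rewrite -distxy; case: hz => [yz|->]; last exact: leqnSn.
    by apply: dist_adjr => //; rewrite adj_sym.
  have ha : (dist R G (val a) (val z) <= (dist R G (val a) y).+1)%N.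
    by case: hz => [yz|->]; [exact: dist_adjr|exact: leqnSn].
  have : [\/ u cx + v cy = d%:Z - 2, u cx + v cy = d%:Z - 1 | u cx + v cy = d%:Z].
    suff : u cx + v cy = d%:Z - 2 \/
      u cx + v cy = d%:Z - 1 \/ u cx + v cy = d%:Z.
      by case=> [|[]] ->; [constructor 1|constructor 2|constructor 3].
    (* The tight pairs (x, z), (a, y) and the constraint at (a, z) give j >= d(x, z) + d(a, y) -
       d(a, z) >= (d - 1) - 1, while j <= d is the constraint at (x, y). *)
    move: h1 h2 ez ea hx ha; lia.
  rewrite /l /=; case=> ->; rewrite ?intrB; by [constructor 1|constructor 2|constructor 3].
Qed.

Theorem theorem3p2 (R : realType) (V : choiceType) (G : simple_graph V)
    (Gfin : locally_finite G) (x y : V) (delta : nat)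
    (dxy : gdist R G x y = (delta%:R)%:E) (delta_ge2 : (2 <= delta)%N) :
  let f := fun p : R => kappa G p x y in
  concave_on `[0, 1] f /\
  exists s t : R, [/\ 0 <= s, s <= t, t <= 1,
    affine_on `[0, s] f & affine_on `[s, t] f /\ affine_on `[t, 1] f].
Proof.
move=> f; pose W (q : R) := fine (W1 G (mu G q x) (mu G q y)).
have WL := W1_supporting_lines Gfin dxy delta_ge2.
have d0 : 0 < delta%:R :> R by rewrite ltr0n ltnW.
have fE q : f q = 1 - W q / delta%:R by rewrite /f /kappa dxy.
split.
  apply: supporting_lines_convex => p p01.
  have [l [lW lp _]] := WL p p01.
  (* The negated curvature is W / delta - 1; the same affine map is applied to both endpoint values
     of [l]. *)
  exists (l.1 / delta%:R - 1, l.2 / delta%:R - 1).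
  have lE q : line (l.1 / delta%:R - 1, l.2 / delta%:R - 1) q =
      line l q / delta%:R - 1 by rewrite /line /=; ring.
  split=> [q q01|]; rewrite lE fE opprB; last by rewrite lp.
  by rewrite lerD2r ler_pM2r ?invr_gt0 // lW.
have [l1 [l2 [l3 WE]]] := supporting_lines_max3 WL.
have [s [t [s0 st t1 A1 [A2 A3]]]] := max3_pieces WE.
(* The curvature is an affine image of [W], so it has the same breakpoints. *)
have aff D : affine_on D W -> affine_on D f.
  move=> [a [b ab]]; exists (- a / delta%:R), (1 - b / delta%:R) => q /ab h.
  by rewrite fE h; ring.
exists s, t; split=> //; first exact: aff.
by split; exact: aff.
Qed.
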